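(* Let $n=2p$, where $p$ is an odd prime. A sequence $S$ in $\mathbb{Z}_n$ is a $U(n)$-extremal sequence for the Gao constant if and only if $S$ is $U(n)$-equivalent to a sequence of length $n+1$ having one of the following forms: $(\star)$ $\ (b_1,\ p_1b_2,\ \underbrace{0,\ldots,0}_{n-1\text{ times}})$, where $\{p_1,p_2\}=\{2,p\}$ and $b_1,b_2$ are integers with $b_i$ coprime to $p_i$ for $i=1,2$; $(\ast)$ $\ (b,\ \underbrace{p,\ldots,p}_{m\text{ times}},\ \underbrace{0,\ldots,0}_{n-m\text{ times}})$, where $b$ is an integer coprime to $p$ and $m$ is an odd integer with $1\le m\le n$; $(\ast\ast)$ $\ (c,\ 1,\ \underbrace{p,\ldots,p}_{n-1\text{ times}})$, where $c$ is an even integer.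
   Context: $\mathbb{Z}_n=\mathbb{Z}/n\mathbb{Z}$ and $U(n)$ is its group of units; integers are identified with their images in $\mathbb{Z}_n$. A sequence is a finite list $(x_1,\ldots,x_l)$ of elements of $\mathbb{Z}_n$ (repetitions allowed); a subsequence is obtained by restricting to a subset of the indices. For $A\subseteq\mathbb{Z}_n$, a subsequence of $(x_1,\ldots,x_l)$ with index set $I$ is an $A$-weighted zero-sum subsequence if $I\ne\emptyset$ and there exist $a_i\in A$ ($i\in I$) with $\sum_{i\in I}a_ix_i=0$. The $A$-weighted Gao constant $E_A(n)$ is the least positive integer $k$ such that every sequence of length $k$ in $\mathbb{Z}_n$ has an $A$-weighted zero-sum subsequence of length $n$. An $A$-extremal sequence for the Gao constant is a sequence in $\mathbb{Z}_n$ of length $E_A(n)-1$ which has no $A$-weighted zero-sum subsequence of length $n$. For a subgroup $A$ of $U(n)$, two sequences $(x_1,\ldots,x_l)$ and $(y_1,\ldots,y_l)$ in $\mathbb{Z}_n$ are $A$-equivalent if there exist $c\in U(n)$, a permutation $\sigma$ of $\{1,\ldots,l\}$ and $a_1,\ldots,a_l\in A$ such that $c\,y_{\sigma(i)}=a_ix_i$ for all $1\le i\le l$. *)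

(* Defs.v *)
From HB Require Import structures.
From mathcomp Require Import all_boot all_order all_algebra all_fingroup.

Set Implicit Arguments.
Unset Strict Implicit.
Unset Printing Implicit Defensive.

Import GRing.Theory.
Local Open Scope ring_scope.

(* 'Z_n is the ring Z/nZ only for 1 < n; the definitions below are meant for
   such n. *)

Definition Zunits (n : nat) : {set 'Z_n} :=
  [set x : 'Z_n | x \is a GRing.unit].

Definition weighted_zero_sum (n : nat) (A : {set 'Z_n}) (s : seq 'Z_n)
    (I : {set 'I_(size s)}) : Prop :=
  I != set0 /\
  exists a : 'I_(size s) -> 'Z_n,
    (forall i, i \in I -> a i \in A) /\ \sum_(i in I) a i * s`_i = 0.

Definition has_weighted_zero_sum (n : nat) (A : {set 'Z_n}) (len : nat)
    (s : seq 'Z_n) : Prop :=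
  exists I : {set 'I_(size s)}, #|I| = len /\ weighted_zero_sum A I.

Definition gao_bound (n : nat) (A : {set 'Z_n}) (k : nat) : Prop :=
  forall s : seq 'Z_n, size s = k -> has_weighted_zero_sum A n s.

(* E_A(n) = k, given as a relation: k is unique when it exists, and none exists
   for, e.g., A empty. *)
Definition is_gao_constant (n : nat) (A : {set 'Z_n}) (k : nat) : Prop :=
  [/\ (0 < k)%N, gao_bound A k
    & forall j : nat, (0 < j)%N -> gao_bound A j -> (k <= j)%N].

Definition gao_extremal (n : nat) (A : {set 'Z_n}) (s : seq 'Z_n) : Prop :=
  (exists2 k : nat, is_gao_constant A k & size s = (k - 1)%N) /\
  ~ has_weighted_zero_sum A n s.

(* An equivalence relation when A is a subgroup of the group of units. *)
Definition weight_equiv (n : nat) (A : {set 'Z_n}) (x y : seq 'Z_n) : Prop :=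
  size x = size y /\
  exists (c : 'Z_n) (sigma : {perm 'I_(size x)}) (a : 'I_(size x) -> 'Z_n),
    [/\ c \in Zunits n, (forall i, a i \in A)
      & forall i : 'I_(size x), c * y`_(sigma i) = a i * x`_i].

Definition form_star (n p : nat) (t : seq 'Z_n) : Prop :=
  exists (p1 p2 : nat) (b1 b2 : int),
    [/\ [:: p1; p2] =i [:: 2%N; p], coprimez b1 p1, coprimez b2 p2
      & t = [:: b1%:~R, p1%:R * b2%:~R & nseq (n - 1) 0]].

Definition form_ast (n p : nat) (t : seq 'Z_n) : Prop :=
  exists (b : int) (m : nat),
    [/\ coprimez b p, odd m, (1 <= m <= n)%N
      & t = b%:~R :: nseq m p%:R ++ nseq (n - m) 0].

Definition form_astast (n p : nat) (t : seq 'Z_n) : Prop :=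
  exists c : int, (2 %| c)%Z /\ t = [:: c%:~R, 1 & nseq (n - 1) p%:R].

(* Main.v *)
(* By the Chinese remainder theorem, the units of Z/2p are the odd residues not
   divisible by p, and x, y are unit multiples of each other iff they agree in
   parity and in divisibility by p. Mod 2 the weights are invisible; mod p, the
   nonzero terms can be weighted to sum to zero iff their number is not 1. Hence
   the terms of a sequence can all be weighted to sum to zero iff an even number
   of them are odd and the number not divisible by p is not 1, and the problem
   reduces to counting the four residue types: E(2p) = 2p + 2, and the extremal
   sequences are those of length 2p + 1 in which no deletion of a single term
   leaves a sequence with this property. *)
Require Import Defs.
From mathcomp Require Import all_boot all_order all_algebra all_fingroup.
From mathcomp Require Import zify.

Set Implicit Arguments.
Unset Strict Implicit.
Unset Printing Implicit Defensive.

Import GRing.Theory.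

(** Translates the index sets of the definitions into list subsequences: the positions kept by a
    mask form the set, and [enum I] lists them in increasing order. *)
Lemma subseq_nth_enumP (T : eqType) (x0 : T) (s u : seq T) :
  reflect (exists I : {set 'I_(size s)},
             u = [seq nth x0 s (val i) | i <- enum I])
          (subseq u s).
Proof.
have Es : s = [seq nth x0 s (val i) | i <- enum 'I_(size s)].
  by rewrite (map_comp (nth x0 s) val) val_enum_ord map_nth_iota0 ?take_size.
apply: (iffP idP) => [/subseqP[m szm ->]|[I ->]].
  exists [set i in mask m (enum 'I_(size s))].
  rewrite [in LHS]Es -map_mask; congr map.
  rewrite [LHS]mask_filter ?enum_uniq // enumT /enum_mem.
  by apply: eq_filter => i /=; rewrite inE.
rewrite [X in subseq _ X]Es map_subseq //.
by rewrite enumT filter_subseq.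
Qed.

(** * Residues of elements of Z/n modulo a divisor of n *)

Section Residues.
Local Open Scope ring_scope.
Variables (n d : nat).
Hypotheses (n_gt1 : (1 < n)%N) (dn : (d %| n)%N).
Implicit Types x y : 'Z_n.

Lemma Zp_natD x y : ((x + y)%R = x + y %[mod d])%N.
Proof. by apply: modn_dvdm; rewrite Zp_cast. Qed.

Lemma Zp_natM x y : ((x * y)%R = x * y %[mod d])%N.
Proof. by apply: modn_dvdm; rewrite Zp_cast. Qed.

Lemma dvdn_ZpD x y : (d %| x)%N -> (d %| (x + y)%R)%N = (d %| y)%N.
Proof. by move=> dx; rewrite /dvdn Zp_natD -/(dvdn _ _) dvdn_addr. Qed.

Lemma dvdn_ZpM x y : (d %| (x * y)%R)%N = (d %| x * y)%N.
Proof. by rewrite /dvdn Zp_natM. Qed.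

Lemma dvdn_ZpN x : (d %| (- x)%R)%N = (d %| x)%N.
Proof.
have N y : (d %| y)%N -> (d %| (- y)%R)%N.
  by move=> dy; rewrite -(dvdn_ZpD (- y) dy) subrr dvdn0.
by apply/idP/idP => [/N|/N //]; rewrite opprK.
Qed.

Lemma dvdn_ZpB x y : (d %| (x - y)%R)%N = (x == y %[mod d])%N.
Proof.
have := Zp_natD (x - y) y; rewrite subrK => ->.
by rewrite -[X in _ == X %[mod _]]add0n eqn_modDr mod0n.
Qed.

Lemma dvdn_Zp_nat k : (d %| (k%:R : 'Z_n))%N = (d %| k)%N.
Proof. by rewrite val_Zp_nat // /dvdn modn_dvdm. Qed.

Lemma dvdn_Zp_int (b : int) : (d %| (b%:~R : 'Z_n))%N = (d %| `|b|)%N.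
Proof. by case: b => k; rewrite /intmul ?dvdn_ZpN dvdn_Zp_nat. Qed.

End Residues.

(** * Parity and divisibility by p in Z/2p *)

Section TwoP.
Local Open Scope ring_scope.
Variable p : nat.
Hypotheses (p_prime : prime p) (p_odd : odd p).
Local Notation n := (2 * p)%N.
Implicit Types (x y t a : 'Z_n) (s u v : seq 'Z_n).

Let n_gt1 : (1 < n)%N.
Proof. by have := prime_gt1 p_prime; lia. Qed.
Let two_dvd : (2 %| n)%N. Proof. exact: dvdn_mulr. Qed.
Let p_dvd : (p %| n)%N. Proof. exact: dvdn_mull. Qed.

Lemma odd_ZpD x y : odd (x + y)%R = odd x (+) odd y.
Proof.
by rewrite -oddD; apply: (can_inj oddb); rewrite -!modn2 (Zp_natD n_gt1).
Qed.

Lemma odd_ZpM x y : odd (x * y)%R = odd x && odd y.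
Proof.
by rewrite -oddM; apply: (can_inj oddb); rewrite -!modn2 (Zp_natM n_gt1).
Qed.

Lemma odd_Zp_nat k : odd (k%:R : 'Z_n) = odd k.
Proof. by apply: negb_inj; rewrite -!dvdn2 dvdn_Zp_nat. Qed.

Lemma odd_Zp_int (b : int) : odd (b%:~R : 'Z_n) = odd `|b|.
Proof. by apply: negb_inj; rewrite -!dvdn2 dvdn_Zp_int. Qed.

Lemma odd_ZpN x : odd (- x)%R = odd x.
Proof. by apply: negb_inj; rewrite -!dvdn2 dvdn_ZpN. Qed.

Lemma unit_ZpE x : (x \is a GRing.unit) = odd x && ~~ (p %| x)%N.
Proof.
rewrite -[x in LHS]natr_Zp unitZpE // coprimeMl coprime2n.
by rewrite prime_coprime.
Qed.

(** Injectivity in the Chinese remainder theorem: the coprime numbers 2 and [p] divide the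
    representative of [x - y], which is less than [2 * p]. *)
Lemma Zp_eq x y : odd x = odd y -> (x = y %[mod p])%N -> x = y.
Proof.
move=> oxy /eqP; rewrite -(dvdn_ZpB n_gt1) // => pxy.
apply/subr0_eq/val_inj; rewrite [RHS]/=.
have: (n %| (x - y)%R)%N.
  rewrite Gauss_dvd ?coprime2n // pxy andbT dvdn2.
  by rewrite odd_ZpD odd_ZpN oxy addbb.
have lt_n : ((x - y)%R < n)%N.
  by rewrite -[X in (_ < X)%N](Zp_cast n_gt1) ltn_ord.
move/dvdn_leq; have [//|_ /(_ isT)] := posnP (x - y)%R.
by rewrite leqNgt lt_n.
Qed.

Lemma unit_mul_modP x t : ~~ (p %| x)%N -> ~~ (p %| t)%N ->
  exists2 a, a \is a GRing.unit & ((a * x)%R = t %[mod p])%N.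
Proof.
move=> px pt; have cpx : coprime p x by rewrite prime_coprime.
(* [chinese p x t 0] is congruent to [t] mod [p] and divisible by [x]; the quotient [k] is the
   weight sought, up to parity. *)
have /dvdnP[k Ek] : (x %| chinese p x t 0)%N.
  by rewrite /dvdn chinese_modr ?mod0n.
have kx : (k * x = t %[mod p])%N by rewrite -Ek chinese_modl.
(* Adding the odd number [p] makes [k] odd without changing it mod [p]. *)
pose k' := (if odd k then k else k + p)%N.
have k'x : (k' * x = t %[mod p])%N.
  by rewrite -kx /k'; case: odd => //; rewrite mulnDl -modnDmr modnMr addn0.
have ok' : odd k' by rewrite /k'; case: ifPn => // /negPf; rewrite oddD => ->.
exists k'%:R; last first.
  by rewrite (Zp_natM n_gt1) // val_Zp_nat // -modnMml modn_dvdm // modnMml.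
rewrite unit_ZpE odd_Zp_nat ok' dvdn_Zp_nat //=; apply: contra pt => pk.
by rewrite /dvdn -k'x -/(dvdn _ _) dvdn_mulr.
Qed.

(** * Residue types and the orbits of the unit group *)

(** Type [(true, true)] consists of the units, [(false, true)] of the nonzero even residues,
    [(true, false)] of [p] alone and [(false, false)] of 0 alone. *)
Definition residue_type x : bool * bool := (odd x, ~~ (p %| x)%N).

Definition ntype b c s := count (fun x => residue_type x == (b, c)) s.

(** Written through the four type counts, so that the later case analyses are linear arithmetic in
    four numbers. *)
Definition n_odd s := (ntype true false s + ntype true true s)%N.
Definition n_nonzero s := (ntype false true s + ntype true true s)%N.

Lemma residue_type_unitM a x : a \is a GRing.unit ->
  residue_type (a * x) = residue_type x.
Proof.
rewrite unit_ZpE /residue_type => /andP[oa pa].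
by rewrite odd_ZpM oa dvdn_ZpM // Euclid_dvdM // (negPf pa).
Qed.

(** If [p] divides both elements, parity makes them equal; otherwise [unit_mul_modP] gives a unit
    correct mod [p], and units preserve parity. *)
Lemma residue_typeP x y : residue_type x = residue_type y ->
  exists2 a, a \is a GRing.unit & y = a * x.
Proof.
case=> oxy /negb_inj pxy; case: (boolP (p %| x)%N) => px.
  exists 1; rewrite ?unitr1 // mul1r; apply: Zp_eq => //.
  by move: (px); rewrite pxy => py; rewrite (eqP px) (eqP py).
have py : ~~ (p %| y)%N by rewrite -pxy.
have [a Ua axy] := unit_mul_modP px py; exists a => //.
by apply: Zp_eq => //; case: (residue_type_unitM x Ua) => ->.
Qed.

(* As 2 is invertible mod p, p cannot divide both t - x and t + x. *)
Lemma unit_sub_nondvd x t : ~~ (p %| x)%N ->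
  exists2 a, a \is a GRing.unit & ~~ (p %| (t - a * x)%R)%N.
Proof.
move=> px; case: (boolP (p %| (t - 1 * x)%R)%N) => [p1|]; last first.
  by exists 1; rewrite ?unitr1.
exists (-1); rewrite ?unitrN1 //; apply: contra px => p2.
have : (p %| ((t + x) - (t - x))%R)%N.
  rewrite dvdn_ZpD //; last by move: p2; rewrite mulN1r opprK.
  by rewrite dvdn_ZpN //; move: p1; rewrite mul1r.
rewrite opprB addrC addrA subrK.
have -> : x + x = 2%:R * x by rewrite mulr_natl mulr2n.
rewrite dvdn_ZpM // Euclid_dvdM // dvdn_Zp_nat // => /orP[|//].
by rewrite dvdn_prime2 // => /eqP Ep; have := p_odd; rewrite {1}Ep.
Qed.

(** * Unit-weighted sums of all the terms *)

(* The condition for [t] to be a unit-weighted sum of all the terms of [s]. *)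
Definition reachable t s :=
  [&& odd t == odd (n_odd s), (n_nonzero s == 0%N) ==> (p %| t)%N
    & (n_nonzero s == 1%N) ==> ~~ (p %| t)%N].

Lemma n_odd_cons x s : n_odd (x :: s) = (odd x + n_odd s)%N.
Proof.
by rewrite /n_odd /ntype /= /residue_type; case: odd; case: dvdn => /=; lia.
Qed.

Lemma n_nonzero_cons x s : n_nonzero (x :: s) = (~~ (p %| x) + n_nonzero s)%N.
Proof.
by rewrite /n_nonzero /ntype /= /residue_type; case: odd; case: dvdn => /=; lia.
Qed.

(** The choice of [a] matters only when [p] does not divide [x]. If all of [s] vanishes mod [p],
    [a * x] must equal [t] mod [p]; otherwise it is enough that [t - a * x] is nonzero mod [p]. *)
Lemma reachable_cons t x s :
  reachable t (x :: s) <->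
  exists2 a, a \is a GRing.unit & reachable (t - a * x) s.
Proof.
(* Since [a] is odd, the parity condition on [t - a * x] and [s] is the one on [t] and [x :: s],
   whatever [a] is. *)
have rE a : a \is a GRing.unit -> reachable (t - a * x) s =
    [&& odd t == odd (n_odd (x :: s)),
        (n_nonzero s == 0%N) ==> (p %| (t - a * x)%R)%N
      & (n_nonzero s == 1%N) ==> ~~ (p %| (t - a * x)%R)%N].
  rewrite unit_ZpE n_odd_cons oddD oddb => /andP[oa _]; congr (_ && _).
  by rewrite odd_ZpD odd_ZpN odd_ZpM oa; case: odd; case: odd; case: odd.
rewrite {1}/reachable n_nonzero_cons; split => [/and3P[ot p0 p1]|[a Ua]].
  case: (boolP (p %| x)%N) p0 p1 => px /= p0 p1.
    exists 1; rewrite ?unitr1 // rE ?unitr1 // ot andTb mul1r addrC.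
    by rewrite dvdn_ZpD ?dvdn_ZpN // p0.
  have [n0|nn0] := eqVneq (n_nonzero s) 0%N.
    rewrite n0 in p1; have [a Ua axt] := unit_mul_modP px p1; exists a => //.
    by rewrite rE // ot n0 dvdn_ZpB // axt !eqxx.
  have [a Ua npa] := unit_sub_nondvd t px; exists a => //.
  by rewrite rE // ot npa implybT (negPf nn0).
rewrite rE // => /and3P[-> p0 p1]; move: p0 p1; rewrite andTb.
have := residue_type_unitM x Ua; case=> _ /negb_inj pax.
case: (boolP (p %| x)%N) => px.
  by rewrite addrC dvdn_ZpD ?dvdn_ZpN ?pax // => -> ->.
case: (n_nonzero s) => [|k] // p0 _; apply: contra px => pt.
by move: p0; rewrite dvdn_ZpD // dvdn_ZpN // pax.
Qed.

(** Induction along [reachable_cons]. Weights are functions of the index, so [uniq r] lets the head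
    receive its own weight without disturbing the tail. *)
Lemma unit_weighted_sumP (T : eqType) (r : seq T) (f : T -> 'Z_n) t : uniq r ->
  (exists2 a : T -> 'Z_n, (forall i, a i \is a GRing.unit)
                          & \sum_(i <- r) a i * f i = t) <->
  reachable t (map f r).
Proof.
elim: r t => [|i0 r IH] t /=.
  rewrite /reachable /n_odd /n_nonzero /ntype /= andbT => _; split.
    by case=> a _; rewrite big_nil => <-; rewrite /= dvdn0.
  case/andP=> ot pt; exists (fun=> 1) => [i|]; first exact: unitr1.
  rewrite big_nil; apply: Zp_eq; first by rewrite (eqP ot).
  by rewrite (eqP pt) mod0n.
case/andP=> ri Ur; rewrite reachable_cons; split.
  case=> a Ua; rewrite big_cons => <-; exists (a i0) => //.
  by rewrite addrAC subrr add0r; apply/(IH _ Ur); exists a.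
case=> b Ub /(IH _ Ur)[a Ua Ea].
exists (fun i => if i == i0 then b else a i) => [i|]; first by case: eqP.
rewrite big_cons eqxx -[t](subrK (b * f i0)) addrC -Ea; congr (_ + _).
rewrite !big_seq; apply: eq_bigr => i ir; case: eqP => // ei.
by rewrite -ei ir in ri.
Qed.

(** The condition [reachable] for the target 0. *)
Definition balanced s := ~~ odd (n_odd s) && (n_nonzero s != 1%N).

Lemma reachable0 s : reachable 0 s = balanced s.
Proof.
by rewrite /reachable /balanced dvdn0 implybT implybF /= eq_sym eqbF_neg.
Qed.

(** * Weighted zero-sum subsequences as balanced subsequences *)

Lemma ntype_perm b c s u : perm_eq s u -> ntype b c s = ntype b c u.
Proof. by move/seq.permP; apply. Qed.

Lemma balanced_perm s u : perm_eq s u -> balanced s = balanced u.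
Proof.
by move=> su; rewrite /balanced /n_odd /n_nonzero !(ntype_perm _ _ su).
Qed.

(** Eliminates weights and indices: [u] holds the chosen terms and [v] the deleted ones. *)
Lemma has_weighted_zero_sumP s :
  has_weighted_zero_sum (Zunits n) n s <->
  exists u v, [/\ perm_eq s (u ++ v), size u = n & balanced u].
Proof.
split=> [[I [szI [_ [a [Ua Ea]]]]]|[u [v [su szu bu]]]].
  have /perm_to_subseq[v sv] : subseq [seq s`_(val i) | i <- enum I] s.
    by apply/(subseq_nth_enumP 0); exists I.
  exists [seq s`_(val i) | i <- enum I], v; split=> //.
    by rewrite size_map -cardE.
  rewrite -reachable0; apply/unit_weighted_sumP; first exact: enum_uniq.
  (* [unit_weighted_sumP] asks for a unit at every index, hence the value 1 outside [I]. *)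
  exists (fun i => if i \in I then a i else 1) => [i|].
    by case: ifP => [/Ua|_]; rewrite ?unitr1 // inE.
  by rewrite big_enum -[RHS]Ea; apply: eq_bigr => i ->.
(* [u] is only a sub-multiset of [s]; a rearrangement [u'] of it is a genuine subsequence. *)
have /count_subseqP[u' su' uu'] : forall x, (count_mem x u <= count_mem x s)%N.
  by move=> x; rewrite (seq.permP su) count_cat leq_addr.
have /(subseq_nth_enumP 0)[I EI] := su'.
have szI : #|I| = n.
  by rewrite cardE -(size_map (fun i => s`_(val i))) -EI
    -(perm_size uu').
exists I; split=> //; split; first by rewrite -card_gt0 szI; lia.
move: bu; rewrite (balanced_perm uu') EI -reachable0.
case/unit_weighted_sumP; rewrite ?enum_uniq // => a Ua Ea.
exists a; split=> [i _|]; first by rewrite inE.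
by rewrite -[RHS]Ea big_enum.
Qed.

(** * Sequences of length n + 1 and deletion of one term *)

Lemma ntype_gt0P b c s : (0 < ntype b c s)%N ->
  exists2 x, residue_type x = (b, c) & perm_eq s (x :: rem x s).
Proof.
rewrite -has_count => /hasP[x xs /eqP tx]; exists x => //.
exact: perm_to_rem.
Qed.

Lemma size_ntype s :
  size s = (ntype false false s + ntype false true s
            + ntype true false s + ntype true true s)%N.
Proof.
elim: s => //= x s ->; rewrite /ntype /=.
by case: residue_type => [[] []] /=; lia.
Qed.

Lemma ntype_cons b c x s :
  ntype b c (x :: s) = ((residue_type x == (b, c)) + ntype b c s)%N.
Proof. by []. Qed.

(** In the first two patterns one term is nonzero mod [p] (odd, respectively even) and [p] occurs an
    odd number of times. In the last two there is one such term of each parity, and no 0,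
    respectively no [p]. *)
Definition exceptional s :=
  [|| [&& ntype false true s == 0, ntype true true s == 1
        & odd (ntype true false s)],
      [&& ntype false true s == 1, ntype true true s == 0
        & odd (ntype true false s)],
      [&& ntype false true s == 1, ntype true true s == 1
        & ntype false false s == 0]
    | [&& ntype false true s == 1, ntype true true s == 1
        & ntype true false s == 0]]%N.

Lemma perm_has_weighted_zero_sum s u v :
  perm_eq s (u ++ v) -> size u = n -> balanced u ->
  has_weighted_zero_sum (Zunits n) n s.
Proof. by move=> su szu bu; apply/has_weighted_zero_sumP; exists u, v. Qed.

Lemma exceptionalP s : size s = n.+1 ->
  ~ has_weighted_zero_sum (Zunits n) n s <-> exceptional s.
Proof.
move=> szs; split=> [no|exc /has_weighted_zero_sumP[u [v [su szu]]]].
  (* Deleting a term of type [(b, c)] lowers the two counts by [b] and [c], read as 0 or 1; the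
     result must not be balanced. *)
  have rem1 b c : (0 < ntype b c s)%N ->
      odd (n_odd s - b) || (n_nonzero s - c == 1)%N.
    case/ntype_gt0P => x tx sx.
    have nx b' c' : ntype b' c' s
        = (((b, c) == (b', c')) + ntype b' c' (rem x s))%N.
      by rewrite (ntype_perm _ _ sx) ntype_cons tx.
    apply: contra_notT no; rewrite negb_or => cond.
    apply: (@perm_has_weighted_zero_sum _ (rem x s) [:: x]).
    - by rewrite (perm_trans sx) // cats1 perm_sym perm_rcons.
    - by move: (perm_size sx); rewrite szs /= => -[].
    move: cond; rewrite /balanced /n_odd /n_nonzero !nx.
    by clear; case: b; case: c => /=; lia.
  have := rem1 false false; have := rem1 false true.
  have := rem1 true false; have := rem1 true true.
  move: (size_ntype s); rewrite szs /n_odd /n_nonzero /exceptional.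
  move: (ntype true true s) (ntype true false s) => a b.
  move: (ntype false true s) (ntype false false s) => c d /=; clear.
  rewrite !subn0 !subn1.
  (* With no term or at least three terms nonzero mod [p], only parity can fail. If both parities
     occur, some deletion corrects it; if only one does, [n] or 0 odd terms remain, an even number.
     One or two such terms give the exceptional patterns. *)
  by case: a => [|[|[|a]]]; case: c => [|[|[|c]]] /=; lia.
have szv : size v = 1%N.
  by move: (perm_size su); rewrite size_cat szs szu -addn1 => /addnI.
case: v szv su => [|x []] // _ su.
have nx b c : ntype b c s = ((residue_type x == (b, c)) + ntype b c u)%N.
  by rewrite (ntype_perm _ _ su) /ntype count_cat /= addn0 addnC.
move: exc; have := size_ntype u; rewrite szu /exceptional !nx /balanced.
rewrite /n_odd /n_nonzero.
move: (ntype true true u) (ntype true false u) => a b.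
move: (ntype false true u) (ntype false false u) => c d; clear.
case: residue_type => [[] []]; rewrite /= ?add0n ?add1n; lia.
Qed.

(** * The upper bound for the Gao constant *)

Lemma gao_bound_add2 : gao_bound (Zunits n) n.+2.
Proof.
move=> s szs.
(* Types of two terms whose deletion leaves a balanced sequence. The second inequality asks for two
   terms of the type when both types coincide. *)
pose ok b c b' c' := [&& 0 < ntype b c s, ((b, c) == (b', c')) < ntype b' c' s,
  ~~ odd (n_odd s - b - b') & n_nonzero s - c - c' != 1]%N.
suff /existsP[[[b c] [b' c']] /and4P[pos pos' oddP nzP]] :
    [exists q : bool * bool * (bool * bool), ok q.1.1 q.1.2 q.2.1 q.2.2].
  have [x tx sx] := ntype_gt0P pos.
  have nx d e : ntype d e s = (((b, c) == (d, e)) + ntype d e (rem x s))%N.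
    by rewrite (ntype_perm _ _ sx) ntype_cons tx.
  have [|y ty sy] := @ntype_gt0P b' c' (rem x s).
    by move: pos'; rewrite nx -[X in (X < _)%N]addn0 ltn_add2l.
  have ny d e : ntype d e (rem x s)
      = (((b', c') == (d, e)) + ntype d e (rem y (rem x s)))%N.
    by rewrite (ntype_perm _ _ sy) ntype_cons ty.
  apply: (@perm_has_weighted_zero_sum _ (rem y (rem x s)) [:: x; y]).
  - by rewrite (perm_trans sx) // perm_sym perm_catC /= perm_cons perm_sym.
  - by move: (perm_size sx); rewrite szs /= (perm_size sy) => -[].
  move: oddP nzP; rewrite /balanced /n_odd /n_nonzero !nx !ny /=.
  clear; case: b; case: c; case: b'; case: c' => /=; lia.
apply: contraT; rewrite negb_exists => /forallP no.
have {}no b c b' c' : ~~ ok b c b' c' by exact: (no (b, c, (b', c'))).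
(* All ten unordered pairs of types; linear arithmetic shows that they cannot all fail. *)
have := no false false false false; have := no true false true false.
have := no false true false true; have := no true true true true.
have := no false false false true; have := no false false true false.
have := no false false true true; have := no false true true false.
have := no false true true true; have := no true false true true.
have p_ge3 : (3 <= p)%N.
  by have := prime_gt1 p_prime; move: p_odd; clear; case: p => [|[|[|]]].
move: (size_ntype s) p_ge3; rewrite szs /ok /n_odd /n_nonzero; clear.
move: (ntype true true s) (ntype true false s) => a b.
move: (ntype false true s) (ntype false false s) => c d /=.
rewrite ?xpair_eqE /= !subn0 !subn1.
case: a => [|[|[|[|a]]]]; case: c => [|[|[|[|c]]]] /=; lia.
Qed.

(** * Equivalence as equality of the multisets of types *)

Lemma ntypeE b c s : ntype b c s = count_mem (b, c) (map residue_type s).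
Proof. by rewrite count_map. Qed.

Lemma residue_type_int (b : int) :
  residue_type b%:~R = (odd `|b|, ~~ (p %| `|b|)%N).
Proof. by rewrite /residue_type odd_Zp_int dvdn_Zp_int. Qed.

Lemma residue_type_nat k : residue_type k%:R = (odd k, ~~ (p %| k)%N).
Proof. exact: (residue_type_int k). Qed.

(** Multiplication by [c] and by the weights preserves types. Conversely, a permutation matching the
    types is completed by [c = 1] and the units of [residue_typeP]. *)
Lemma weight_equivP s (t : seq 'Z_n) :
  weight_equiv (Zunits n) s t <->
  perm_eq (map residue_type s) (map residue_type t).
Proof.
split=> [[szst [c [sigma [a [Uc Ua E]]]]]|st].
  have szt : size (map residue_type t) == size s by rewrite size_map szst.
  apply/(@tuple_permP _ _ _ (Tuple szt)); exists sigma.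
  apply: (@eq_from_nth _ (true, true)); first by rewrite size_map size_tuple.
  rewrite size_map => i ltis; rewrite -[i]/(val (Ordinal ltis)).
  set j := Ordinal ltis; rewrite -tnth_nth tnth_mktuple (tnth_nth (true, true)).
  have lts : (sigma j < size t)%N by rewrite -szst.
  rewrite /= !(nth_map 0) //.
  have Ucu : c \is a GRing.unit by rewrite inE in Uc.
  have Uaj : a j \is a GRing.unit by have := Ua j; rewrite inE.
  by rewrite -(residue_type_unitM _ Uaj) -E residue_type_unitM.
have szst : size s = size t by have := perm_size st; rewrite !size_map.
have szt : size (map residue_type t) == size s by rewrite size_map szst.
have /(@tuple_permP _ _ _ (Tuple szt))[sigma E] := st.
have /fin_all_exists2[a Ua Ea] (i : 'I_(size s)) :
    exists2 a, a \is a GRing.unit & t`_(sigma i) = a * s`_i.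
  apply: residue_typeP.
  have lts : (sigma i < size t)%N by rewrite -szst.
  rewrite -!(nth_map 0 (true, true)) // E -tnth_nth tnth_mktuple.
  by rewrite (tnth_nth (true, true)).
split=> //; exists 1, sigma, a; split=> [|i|i]; rewrite ?inE ?unitr1 //.
by rewrite mul1r.
Qed.

Lemma exceptional_equiv s (t : seq 'Z_n) : weight_equiv (Zunits n) s t ->
  exceptional s = exceptional t.
Proof.
by move/weight_equivP/seq.permP=> st; rewrite /exceptional !ntypeE !st.
Qed.

(** * The three forms and the exceptional patterns *)

Lemma ntype_nseq b c k x :
  ntype b c (nseq k x) = ((residue_type x == (b, c)) * k)%N.
Proof. exact: count_nseq. Qed.

Lemma ntype_cat b c s u : ntype b c (s ++ u) = (ntype b c s + ntype b c u)%N.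
Proof. exact: count_cat. Qed.

Lemma residue_type0 : residue_type 0 = (false, false).
Proof. by rewrite (residue_type_nat 0) dvdn0. Qed.

Lemma residue_type1 : residue_type 1 = (true, true).
Proof. by rewrite (residue_type_nat 1) dvdn1; case: eqP p_prime => // ->. Qed.

Lemma residue_type2 : residue_type 2%:R = (false, true).
Proof.
rewrite (residue_type_nat 2) dvdn_prime2 //.
by case: eqP => // p2; have := p_odd; rewrite p2.
Qed.

Lemma residue_typep : residue_type p%:R = (true, false).
Proof. by rewrite residue_type_nat p_odd dvdnn. Qed.

Definition ntypeEs :=
  (ntype_cons, ntype_cat, ntype_nseq,
   residue_type0, residue_type1, residue_type2, residue_typep).

Lemma exceptional_star (t : seq 'Z_n) : form_star p t -> exceptional t.
Proof.
case=> p1 [p2 [b1 [b2 [E cb1 cb2 ->]]]].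
have [[Ep1 Ep2]|[Ep1 Ep2]] : (p1 = 2 /\ p2 = p) \/ (p1 = p /\ p2 = 2).
- have := E p1; have := E p2; have := E 2; have := E p.
  by rewrite !inE !eqxx ?orbT /=; lia.
- move: cb1 cb2; rewrite Ep1 Ep2 !coprimezE /= coprimen2 => ob1.
  rewrite coprime_sym prime_coprime // => pb2.
  have t2 : residue_type (2%:R * b2%:~R) = (false, true).
    rewrite -[2%:R]/(2%:~R) -intrM residue_type_int abszM oddM /=.
    rewrite Euclid_dvdM // (negPf pb2) orbF.
    by have := residue_type2; rewrite residue_type_nat.
  rewrite /exceptional !ntypeEs t2 residue_type_int ob1.
  (* If [p] divides [b1], this is the second pattern with a single [p]; otherwise the fourth. *)
  by case: dvdn => /=; lia.
move: cb1 cb2; rewrite Ep1 Ep2 !coprimezE /= coprimen2.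
rewrite coprime_sym prime_coprime // => pb1 ob2.
have tp : residue_type (p%:R * b2%:~R) = (true, false).
  rewrite -[p%:R]/(p%:~R) -intrM residue_type_int abszM oddM /=.
  by rewrite p_odd ob2 dvdn_mulr.
rewrite /exceptional !ntypeEs tp residue_type_int pb1.
(* The term [p * b2] is the only one of type [(true, false)]; the parity of [b1] selects the first
   or second pattern. *)
by case: odd => /=; lia.
Qed.

Lemma exceptional_ast (t : seq 'Z_n) : form_ast p t -> exceptional t.
Proof.
case=> b [m [cb om /andP[m1 mn] ->]].
move: cb; rewrite coprimezE coprime_sym prime_coprime //= => pb.
rewrite /exceptional !ntypeEs residue_type_int pb.
by case: (odd `|b|) => /=; rewrite !mul0n !mul1n ?addn0 ?add0n om.
Qed.

Lemma exceptional_astast (t : seq 'Z_n) : form_astast p t -> exceptional t.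
Proof.
case=> c [c2 ->]; have oc : odd `|c| = false.
  by apply/negbTE; rewrite -dvdn2.
rewrite /exceptional !ntypeEs residue_type_int oc.
(* If [p] divides [c], the odd number [n - 1] of terms [p] gives the first pattern; otherwise it is
   the third. *)
by case: dvdn => /=; lia.
Qed.

Lemma weight_equiv_ntype s (t : seq 'Z_n) :
  (forall b c, ntype b c s = ntype b c t) -> weight_equiv (Zunits n) s t.
Proof.
move=> E; apply/weight_equivP/allP => -[b c] _ /=.
by rewrite -!ntypeE E.
Qed.

(** Equivalence sees only type counts, so the representatives 1, 2, [p] and 0 of the four types
    suffice as terms of [t]. *)
Lemma exceptional_form s : size s = n.+1 -> exceptional s ->
  exists t : seq 'Z_n, [/\ size t = n.+1, weight_equiv (Zunits n) s t
    & [\/ form_star p t, form_ast p t | form_astast p t]].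
Proof.
move=> szs exc; have sz := size_ntype s; rewrite szs in sz.
suff [t st ft] : exists2 t : seq 'Z_n, forall b c, ntype b c s = ntype b c t
    & [\/ form_star p t, form_ast p t | form_astast p t].
  have eqv := weight_equiv_ntype st; exists t; split=> //.
  by rewrite -szs; case: eqv.
case/or4P: exc => /and3P[/eqP N01 /eqP N11 N10].
- exists (1%:~R :: nseq (ntype true false s) p%:R
          ++ nseq (n - ntype true false s) 0).
    by move=> [] []; rewrite !ntypeEs /=; lia.
  constructor 2; exists 1, (ntype true false s); split=> //; last by lia.
  by rewrite coprimezE coprime1n.
- exists (2%:~R :: nseq (ntype true false s) p%:R
          ++ nseq (n - ntype true false s) 0).
    by move=> [] []; rewrite !ntypeEs /=; lia.
  constructor 2; exists 2, (ntype true false s); split=> //; last by lia.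
  by rewrite coprimezE coprime2n.
- exists [:: 2%:~R, 1 & nseq (n - 1) p%:R].
    by move=> [] []; rewrite !ntypeEs /=; lia.
  by constructor 3; exists 2.
exists [:: 1%:~R, 2%:R * 1%:~R & nseq (n - 1) 0].
  by move=> [] []; rewrite mulr1 !ntypeEs /=; lia.
constructor 1; exists 2%N, p, 1, 1; split=> //.
by rewrite coprimezE coprime1n.
Qed.

(** * The Gao constant and the extremal sequences *)

Lemma is_gao_constant_add2 : is_gao_constant (Zunits n) n.+2.
Proof.
split=> // [|j j_gt0 bj]; first exact: gao_bound_add2.
rewrite leqNgt; apply/negP => lt_j.
(* An exceptional sequence of length [n.+1], of the fourth pattern. A bound [j] below [n.+2] would
   apply to its prefix of length [j] and produce a zero-sum subsequence of [s0]. *)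
pose s0 : seq 'Z_n := [:: 1, 2%:R & nseq (n - 1) 0].
have szs0 : size s0 = n.+1 by rewrite /= size_nseq; lia.
have exc : exceptional s0 by rewrite /exceptional !ntypeEs /=; lia.
have /(exceptionalP szs0) := exc; apply.
have /bj/has_weighted_zero_sumP[u [v [su szu bu]]] : size (take j s0) = j.
  by rewrite size_takel ?szs0.
apply: (@perm_has_weighted_zero_sum _ u (v ++ drop j s0)) => //.
by rewrite catA -[X in perm_eq X _](cat_take_drop j) perm_cat2r.
Qed.

Lemma gao_extremalP s :
  gao_extremal (Zunits n) s <-> size s = n.+1 /\ exceptional s.
Proof.
have gao2 := is_gao_constant_add2.
split=> [[[k gaok szs] no]|[szs exc]]; last first.
  split; last exact/(exceptionalP szs).
  by exists n.+2; rewrite // szs subn1.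
have Ek : k = n.+2.
  case: gaok gao2 => k0 bk mink [_ b2 min2].
  by apply/eqP; rewrite eqn_leq mink // min2.
rewrite Ek subn1 in szs; split=> //; exact/(exceptionalP szs).
Qed.

End TwoP.

Theorem theorem3 (p n : nat) (hp : prime p) (hodd : odd p) (hn : n = 2 * p)
    (s : seq 'Z_n) :
  gao_extremal (Zunits n) s <->
  exists t : seq 'Z_n,
    [/\ size t = n.+1, weight_equiv (Zunits n) s t
      & [\/ form_star p t, form_ast p t | form_astast p t]].
Proof.
subst n; rewrite gao_extremalP //; split=> [[]|[t [szt eqv ft]]].
  exact: exceptional_form.
split; first by case: eqv => ->.
rewrite (exceptional_equiv hp hodd eqv); case: ft.
- exact: exceptional_star.
- exact: exceptional_ast.
exact: exceptional_astast.
Qed.
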